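(* Let $(X,\rho,\mathcal{S})$ be an unbounded complete hyperbolic space, let $\theta\in X$, let $\phi$ be an admissible function and let $\mathcal{M}$ be the set of all nonexpansive self-mappings of $X$, equipped with the metric $d_{\theta,\phi}$. There exists a set $\mathcal{F}\subset\mathcal{M}$ such that $\mathcal{M}\setminus\mathcal{F}$ is $\sqrt{\phi}$-porous in $(\mathcal{M},d_{\theta,\phi})$ and every $f\in\mathcal{F}$ has the following property: there is an $M_f>0$ such that $f(\bar{B}(\theta,M_f))\subset\bar{B}(\theta,M_f)$. If, moreover, $\phi$ satisfies \[ \phi^{-1}\left(\tfrac{t}{a+b}\right)\leq\phi^{-1}\left(\tfrac{t}{a}\right)\phi^{-1}\left(\tfrac{t}{b}\right) \] for all $a,b\geq1$ and $t\in(0,1)$, then $\mathcal{M}\setminus\mathcal{F}$ is $\phi$-porous in $(\mathcal{M},d_{\theta,\phi})$.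
   Context: Hyperbolic spaces. A geodesic metric space is a metric space $(X,\rho)$ such that for all $x,y\in X$ there is an isometric embedding $c\colon[0,\rho(x,y)]\to X$ with $c(0)=x$, $c(\rho(x,y))=y$; the image of such a $c$ is a metric segment connecting $x$ and $y$. A hyperbolic space is a triple $(X,\rho,\mathcal{S})$ where $(X,\rho)$ is a geodesic metric space and $\mathcal{S}$ is a family of metric segments such that: (1) for each pair $x,y\in X$, $\mathcal{S}$ contains a unique metric segment connecting $x$ and $y$, denoted $[x,y]$; (2) for all $x,y\in X$ and $z,w\in[x,y]$ we have $[z,w]\subset[x,y]$; (3) $\rho((1-\lambda)x\oplus\lambda y,(1-\lambda)x\oplus\lambda z)\leq\lambda\rho(y,z)$ for all $x,y,z\in X$ and $\lambda\in[0,1]$, where $(1-\lambda)x\oplus\lambda y$ denotes the unique point of $[x,y]$ at distance $\lambda\rho(x,y)$ from $x$ and $(1-\lambda)\rho(x,y)$ from $y$. We write $\bar{B}(z,r)=\{x\in X\colon\rho(x,z)\leq r\}$. Nonexpansive mappings. A mapping $f\colon X\to X$ is nonexpansive if $\rho(f(x),f(y))\leq\rho(x,y)$ for all $x,y\in X$. Admissible functions. Let $I$ be $(0,1)$ or $(0,1]$. A function $\phi\colon I\to(0,\infty)$ is called admissible here if it is continuous, strictly increasing and satisfies: (C1) there is an $\eta_\phi\in I$ such that $\phi$ is concave on $(0,\eta_\phi)$ and $\phi(\eta_\phi)\geq\eta_\phi$; (C2) $\lim_{t\to0}\phi(t)=0$ and there is a $t\in I$ with $\phi(t)=1$; (C3)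 for every $k\in\mathbb{N}$ there is a $C_k>0$ such that $\phi^{-1}(\frac1m)\leq C_k\,\phi^{-1}(\frac1{k+m})$ for all $m\in\mathbb{N}$; (C4) $\sum_{n=1}^\infty n\,\phi^{-1}(\frac1n)$ converges. (Here $\mathbb{N}=\{1,2,\dots\}$.) Metric. For $f,g\in\mathcal{M}$ put $d_{n,\theta}(f,g)=\sup\{\rho(f(x),g(x))\colon x\in\bar{B}(\theta,n)\}$ and $d_{\theta,\phi}(f,g)=\sum_{n=1}^\infty\phi^{-1}\left(\frac1n\right)\frac{d_{n,\theta}(f,g)}{1+d_{n,\theta}(f,g)}$. Porosity. Let $(M,d)$ be a metric space, $A\subset M$, $x\in A$, $\eta>0$ and $\varphi\colon(0,\eta)\to(0,\infty)$ increasing. Put $\gamma(x,r,A)=\sup\{s>0\colon\exists x'\in M\text{ with }B_M(x',s)\subset B_M(x,r)\setminus A\}$, where $B_M$ denotes open balls and $\sup\emptyset=-\infty$ (so $A$ is not porous at $x$ if $\gamma(x,r,A)=-\infty$ for arbitrarily small $r$). $A$ is $\varphi$-porous at $x$ if $\liminf_{r\to0}\varphi(\gamma(x,r,A))/r>0$, and $\varphi$-porous if it is $\varphi$-porous at each of its points. *)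

(* Defs.v *)
From HB Require Import structures.
From mathcomp Require Import all_boot all_order all_algebra.
From mathcomp Require Import all_classical all_reals all_analysis.

Set Implicit Arguments.
Unset Strict Implicit.
Unset Printing Implicit Defensive.

Import Order.TTheory GRing.Theory Num.Theory.
Import numFieldNormedType.Exports.

Local Open Scope classical_set_scope.
Local Open Scope ring_scope.

Section hyperbolic_spaces.
Context {R : realType} {X : metricType R}.

Definition cball (z : X) (r : R) : set X := [set x | mdist z x <= r].

(* Only the restriction of c to [0, mdist x y] matters. *)
Definition geodesic_path (x y : X) (c : R -> X) : Prop :=
  [/\ {in `[0, mdist x y] &, forall s t, mdist (c s) (c t) = `|s - t|},
      c 0 = x & c (mdist x y) = y].

Definition metric_segment (x y : X) (A : set X) : Prop :=
  exists2 c, geodesic_path x y c & A = c @` `[0, mdist x y].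

(* [x, y]; the choice is unique under [hyperbolic_unique] *)
Definition seg (S : set (set X)) (x y : X) : set X :=
  xget set0 [set A | S A /\ metric_segment x y A].

(* (1 - l) x (+) l y; the point is unique as [x, y] is a geodesic image *)
Definition geod_comb (S : set (set X)) (l : R) (x y : X) : X :=
  xget x [set z | [/\ seg S x y z, mdist x z = l * mdist x y
                    & mdist z y = (1 - l) * mdist x y]].

Record hyperbolic (S : set (set X)) : Prop := {
  hyperbolic_geodesic : forall x y, exists c, geodesic_path x y c ;
  hyperbolic_family : forall A, S A -> exists x y, metric_segment x y A ;
  hyperbolic_unique : forall x y, exists! A, S A /\ metric_segment x y A ;
  hyperbolic_sub : forall x y z w,
    seg S x y z -> seg S x y w -> seg S z w `<=` seg S x y ;
  hyperbolic_comb : forall (x y z : X) (l : R), 0 <= l <= 1 ->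
    mdist (geod_comb S l x y) (geod_comb S l x z) <= l * mdist y z
}.

End hyperbolic_spaces.

(* The library's [completeType] is pointed; this is its defining property for
   a metric space without a distinguished point. *)
Definition complete_metric (R : realType) (X : metricType R) : Prop :=
  forall F : set_system X, ProperFilter F -> cauchy F -> exists l : X, F --> l.

Definition unbounded_metric (R : realType) (X : metricType R) : Prop :=
  ~ exists r : R, forall x y : X, mdist x y <= r.

Section admissible_functions.
Context {R : realType}.

(* A function I -> (0, oo) is a function on R whose values off I are ignored;
   its inverse is only used on the image of I. *)
Definition inv_on (I : set R) (phi : R -> R) : R -> R :=
  'pinv_(fun=> 0) I phi.

Record admissible (I : set R) (phi : R -> R) : Prop := {
  admissible_dom : I = `]0, 1[%classic \/ I = `]0, 1]%classic ;
  admissible_pos : forall t, I t -> 0 < phi t ;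
  admissible_continuous : {within I, continuous phi} ;
  admissible_increasing : {in I &, {homo phi : s t / s < t}} ;
  (* concavity of phi is convexity of - phi *)
  admissible_C1 : exists eta : R,
    [/\ I eta, @convex_function R R^o `]0, eta[%classic (\- phi)
      & eta <= phi eta] ;
  admissible_C2 : phi t @[t --> 0^'+] --> 0 /\ (exists2 t, I t & phi t = 1) ;
  admissible_C3 : forall k : nat, (0 < k)%N -> exists2 C : R, 0 < C &
    forall m : nat, (0 < m)%N ->
      inv_on I phi (m%:R^-1) <= C * inv_on I phi ((k + m)%:R^-1) ;
  admissible_C4 :
    cvgn (fun N : nat => \sum_(1 <= n < N) n%:R * inv_on I phi (n%:R^-1))
}.

End admissible_functions.

Section porosity.
Context {R : realType} {M : metricType R}.

Definition pore_radius (x : M) (r : R) (A : set M) : \bar R :=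
  ereal_sup [set s%:E | s in [set s : R |
    0 < s /\ exists x' : M, ball x' s `<=` ball x r `\` A]].

Lemma pore_radius_le (x : M) (r : R) (A : set M) : A x ->
  (pore_radius x r A <= r%:E)%E.
Proof.
move=> Ax; apply: ge_ereal_sup => _ [s [s0 [x' sub]] <-].
have [x'r _] := sub _ (ballxx x' s0).
have : ~ ball x' s x by move/sub => [].
rewrite lee_fin; move: x'r; rewrite !ballEmdist/= metric_sym => x'r /negP.
by rewrite -leNgt => /le_trans; apply; exact: ltW.
Qed.

(* The gauge phi is a priori only defined on some (0, eta). By
   [pore_radius_le] the radius is -oo or lies in (0, r], so neither the values
   of phi outside (0, eta) nor the clause er_map phi +oo = +oo affect the
   liminf; er_map phi -oo = -oo is the non-porous case. *)
Definition porous_at (phi : R -> R) (A : set M) (x : M) : Prop :=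
  (0 < limf_einf (fun r : R => er_map phi (pore_radius x r A) * (r^-1)%:E)
                 (0%R^'+))%E.

Definition porous (phi : R -> R) (A : set M) : Prop :=
  forall x, A x -> porous_at phi A x.

End porosity.

Definition nonexpansive (R : realType) (X : metricType R) : set (X -> X) :=
  [set f | forall x y, mdist (f x) (f y) <= mdist x y].

Section distance.
Context {R : realType} {X : metricType R}.

Definition dist_ball (theta : X) (n : nat) (f g : X -> X) : R :=
  sup [set mdist (f x) (g x) | x in cball theta n%:R].

Definition dist_phi (theta : X) (I : set R) (phi : R -> R) (f g : X -> X) : R :=
  \big[+%R/0]_(1 <= n <oo)
    (inv_on I phi (n%:R^-1) *
       (dist_ball theta n f g / (1 + dist_ball theta n f g))).

End distance.

Section distance_facts.
Context {R : realType} {X : metricType R} (theta : X).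
Context {I : set R} {phi : R -> R} (adm : admissible I phi).

Lemma admissible_dom_gt0 t : I t -> 0 < t.
Proof.
by case: (admissible_dom adm) => -> /=; rewrite in_itv/= => /andP[].
Qed.

Lemma admissible_itv a b : 0 < a -> I b -> `[a, b] `<=` I.
Proof.
move=> a0; case: (admissible_dom adm) => -> /=; rewrite in_itv/= => /andP[_ b1] t;
  rewrite /= !in_itv/= => /andP[at' tb]; rewrite (lt_le_trans a0 at')/=.
- exact: le_lt_trans tb b1.
- exact: le_trans tb b1.
Qed.

Lemma admissible_surj s : 0 < s <= 1 -> exists2 t, I t & phi t = s.
Proof.
move=> /andP[s0 s1]; have [phi0 [b Ib phib]] := admissible_C2 adm.
have b0 := admissible_dom_gt0 Ib.
have : \forall t \near 0^'+, phi t < s by exact: cvgr_lt phi0 _ s0.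
move=> phis; near (0 : R)^'+ => a.
have a0 : 0 < a by near: a; exact: nbhs_right_gt.
have ab : a <= b by near: a; exact: nbhs_right_le.
have phia : phi a < s by near: a.
have cphi : {within `[a, b], continuous phi}.
  by apply: continuous_subspaceW (admissible_continuous adm); exact: admissible_itv.
have [|c cab <-] := IVT ab cphi (v := s).
  by rewrite phib ge_min (ltW phia)/= le_max s1 orbT.
by exists c => //; exact: (admissible_itv a0 Ib).
Unshelve. all: by end_near. Qed.

Lemma inv_onP s : 0 < s <= 1 -> I (inv_on I phi s) /\ phi (inv_on I phi s) = s.
Proof.
move=> /admissible_surj[t It <-].
have phit : (phi @` I) (phi t) by exists t.
split; last by rewrite /inv_on pinvK// inE.
have inj : {in I &, injective phi}.
  move=> x y xI yI xy; apply/eqP; case: ltgtP => // /(admissible_increasing adm);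
    by rewrite xy ltxx => /(_ _ _)-> .
by rewrite /inv_on -[X in X _](injpinv_image (fun=> 0) inj); exists (phi t).
Qed.

Let w n := inv_on I phi n%:R^-1.

Lemma weight_gt0 n : (0 < n)%N -> 0 < w n.
Proof.
move=> n0; apply: admissible_dom_gt0; apply: (inv_onP _).1.
by rewrite invr_gt0 ltr0n n0/= invf_le1 ?ltr0n// ler1n.
Qed.

Let psum_homo (u : nat -> R) : (forall n, (0 < n)%N -> 0 <= u n) ->
  {homo (fun N : nat => \sum_(1 <= n < N) u n) : n m / (n <= m)%N >-> n <= m}.
Proof.
move=> u0; apply/nondecreasing_seqP => -[|n].
  by rewrite !big_geq.
by rewrite [leRHS]big_nat_recr//= lerDl u0.
Qed.

Let N0 := @nonexpansive R X.

Lemma dist_ball_has_ubound f g n : N0 f -> N0 g ->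
  has_ubound [set mdist (f x) (g x) | x in cball theta n%:R].
Proof.
move=> Nf Ng; exists (n%:R + mdist (f theta) (g theta) + n%:R) => _ [x xB <-].
rewrite (le_trans (metric_triangle _ (g theta) _))// lerD//; last first.
  exact: le_trans (Ng _ _) xB.
rewrite (le_trans (metric_triangle _ (f theta) _))// lerD//.
by rewrite (le_trans (Nf _ _))// metric_sym.
Qed.

Lemma dist_ball_ge f g n x : N0 f -> N0 g -> cball theta n%:R x ->
  mdist (f x) (g x) <= dist_ball theta n f g.
Proof.
by move=> Nf Ng Bx; apply: ub_le_sup; [exact: dist_ball_has_ubound|exists x].
Qed.

Lemma cball_center n : cball theta n%:R theta.
Proof. by rewrite /cball/= mdistxx. Qed.

Lemma dist_ball_ge0 f g n : N0 f -> N0 g -> 0 <= dist_ball theta n f g.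
Proof.
by move=> Nf Ng; apply: le_trans (dist_ball_ge Nf Ng (cball_center n)); exact: mdist_ge0.
Qed.

Lemma dist_ball_triangle f g h n : N0 f -> N0 g -> N0 h ->
  dist_ball theta n f h <= dist_ball theta n f g + dist_ball theta n g h.
Proof.
move=> Nf Ng Nh; apply: ge_sup.
  by exists (mdist (f theta) (h theta)); exists theta => //; exact: cball_center.
move=> _ [x xB <-]; apply: le_trans (metric_triangle _ (g x) _) _.
by rewrite lerD// dist_ball_ge.
Qed.

Let frac_le (a b : R) : 0 <= a -> a <= b -> a / (1 + a) <= b / (1 + b).
Proof.
move=> a0 ab; have b0 := le_trans a0 ab.
rewrite ler_pdivrMr ?ltr_wpDr// mulrAC ler_pdivlMr ?ltr_wpDr//.
by rewrite !mulrDr !mulr1 mulrC lerD2r.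
Qed.

Let frac_triangle (a b c : R) : 0 <= a -> 0 <= b -> 0 <= c -> c <= a + b ->
  c / (1 + c) <= a / (1 + a) + b / (1 + b).
Proof.
move=> a0 b0 c0 cab; apply: le_trans (frac_le c0 cab) _.
rewrite mulrDl lerD// ler_wpM2l// lef_pV2 ?posrE ?ltr_wpDr ?addr_ge0//.
  by rewrite lerD2l lerDl.
by rewrite lerD2l lerDr.
Qed.

Let term f g n := w n * (dist_ball theta n f g / (1 + dist_ball theta n f g)).

Let term_ge0 f g n : N0 f -> N0 g -> (0 < n)%N -> 0 <= term f g n.
Proof.
move=> Nf Ng n0; apply: mulr_ge0; first exact/ltW/weight_gt0.
by rewrite divr_ge0 ?addr_ge0 ?dist_ball_ge0.
Qed.

Let term_le f g n : N0 f -> N0 g -> (0 < n)%N -> term f g n <= n%:R * w n.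
Proof.
move=> Nf Ng n0; rewrite /term mulrC ler_wpM2r ?(ltW (weight_gt0 _))//.
have d0 := dist_ball_ge0 n Nf Ng.
apply: (@le_trans _ _ 1); last by rewrite ler1n.
by rewrite ler_pdivrMr ?ltr_wpDr// mul1r lerDr.
Qed.

Let dist_phi_cvg f g : N0 f -> N0 g ->
  cvgn (fun N : nat => \sum_(1 <= n < N) term f g n).
Proof.
move=> Nf Ng; apply: nondecreasing_is_cvgn.
  by apply: psum_homo => n; exact: term_ge0.
have c4 := admissible_C4 adm.
exists (limn (fun N : nat => \sum_(1 <= n < N) n%:R * w n)) => _ [N _ <-].
apply: le_trans (nondecreasing_cvgn_le _ c4 N); last first.
  by apply: psum_homo => n n0; rewrite mulr_ge0// ltW// weight_gt0.
rewrite big_nat [leRHS]big_nat; apply: ler_sum => n /andP[n0 _].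
exact: term_le.
Qed.

Let dist_phi_ge f g n : N0 f -> N0 g -> (0 < n)%N ->
  term f g n <= dist_phi theta I phi f g.
Proof.
move=> Nf Ng n0.
have h : {homo (fun N : nat => \sum_(1 <= n < N) term f g n) :
    n m / (n <= m)%N >-> n <= m} by apply: psum_homo => k; exact: term_ge0.
apply: le_trans (nondecreasing_cvgn_le h (dist_phi_cvg Nf Ng) n.+1).
rewrite big_nat_recr//= lerDr big_nat; apply: sumr_ge0 => k /andP[k0 _].
exact: term_ge0.
Qed.

Lemma dist_phixx f : dist_phi theta I phi f f = 0.
Proof.
have d0 n : dist_ball theta n f f = 0.
  rewrite /dist_ball (_ : [set _ | _ in _] = [set 0]) ?sup1//.
  apply/seteqP; split => [_ [x _ <-]|_ ->]/=; first exact: mdistxx.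
  by exists theta; [exact: cball_center|exact: mdistxx].
rewrite /dist_phi (_ : (fun N : nat => _) = cst 0) ?lim_cst//.
by apply/funext => N; apply: big1 => n _; rewrite d0 mul0r mulr0.
Qed.

Lemma dist_phi_sym f g : dist_phi theta I phi f g = dist_phi theta I phi g f.
Proof.
suff e n : dist_ball theta n f g = dist_ball theta n g f.
  by rewrite /dist_phi; congr (limn _); apply/funext => N;
    apply: eq_bigr => n _; rewrite e.
rewrite /dist_ball; congr sup; apply/seteqP; split => _ [x xB <-];
  by exists x => //; exact: metric_sym.
Qed.

Lemma dist_phi_positivity f g : N0 f -> N0 g ->
  dist_phi theta I phi f g = 0 -> f = g.
Proof.
move=> Nf Ng d0; apply/funext => x; apply: mdist_positivity.
pose n := (Num.truncn (mdist theta x)).+1.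
have Bx : cball theta n%:R x by rewrite /cball/= ltW// truncnS_gt.
apply/le_anti; rewrite mdist_ge0 andbT (le_trans (dist_ball_ge Nf Ng Bx))//.
have := dist_phi_ge Nf Ng (ltn0Sn _ : (0 < n)%N).
rewrite d0 pmulr_rle0 ?weight_gt0//.
by rewrite pmulr_lle0// invr_gt0 ltr_wpDr// dist_ball_ge0.
Qed.

Lemma dist_phi_triangle f g h : N0 f -> N0 g -> N0 h ->
  dist_phi theta I phi f h <=
  dist_phi theta I phi f g + dist_phi theta I phi g h.
Proof.
move=> Nf Ng Nh.
have cfg := dist_phi_cvg Nf Ng; have cgh := dist_phi_cvg Ng Nh.
rewrite /dist_phi -limD//; apply: ler_lim; [exact: dist_phi_cvg|exact: is_cvgD|].
near=> N; rewrite fctE -big_split/= big_nat [leRHS]big_nat.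
apply: ler_sum => n /andP[n0 _]; rewrite -mulrDr.
rewrite ler_wpM2l ?(ltW (weight_gt0 _))// frac_triangle ?dist_ball_ge0//.
exact: dist_ball_triangle.
Unshelve. all: by end_near. Qed.

End distance_facts.

(* The type depends on theta and adm because its metric does. *)
Definition nonexp_space (R : realType) (X : metricType R) (theta : X)
    (I : set R) (phi : R -> R) (adm : admissible I phi) : Type :=
  set_type (@nonexpansive R X).

Section nonexp_space_metric.
Context {R : realType} {X : metricType R} (theta : X).
Context {I : set R} {phi : R -> R} (adm : admissible I phi).
Local Notation M := (nonexp_space theta adm).

Definition nonexp_fun (f : M) : X -> X := set_val f.

Let dist (f g : M) : R := dist_phi theta I phi (nonexp_fun f) (nonexp_fun g).

Let nonexpP (f : M) : nonexpansive (nonexp_fun f).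
Proof. exact: set_valP. Qed.

Let distxx f : dist f f = 0. Proof. exact: dist_phixx. Qed.

Let dist_positivity f g : dist f g = 0 -> f = g.
Proof. by move=> /(dist_phi_positivity adm (nonexpP f) (nonexpP g))/val_inj. Qed.

Let dist_sym f g : dist f g = dist g f. Proof. exact: dist_phi_sym. Qed.

Let dist_triangle g f h : dist f h <= dist f g + dist g h.
Proof. exact: dist_phi_triangle. Qed.

HB.instance Definition _ := Choice.copy M (set_type (@nonexpansive R X)).
HB.instance Definition _ := @isMetric.Build R M
  dist distxx dist_positivity dist_sym dist_triangle.

Lemma nonexp_mdistE (f g : M) :
  mdist f g = dist_phi theta I phi (nonexp_fun f) (nonexp_fun g).
Proof. by []. Qed.

End nonexp_space_metric.

(* Main.v *)
Require Import Defs.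
From mathcomp Require Import all_boot all_order all_algebra.
From mathcomp Require Import all_classical all_reals all_analysis.
From mathcomp Require Import ring lra.

Import Order.TTheory GRing.Theory Num.Theory.
Import numFieldNormedType.Exports.

Local Open Scope classical_set_scope.
Local Open Scope ring_scope.

(** Contract a nonexpansive [f] towards [theta]: [f' = (1 - g) f (+) g theta].
    The contraction brings points at distance [n] closer to [theta] by [g n], so
    as soon as [g n >= rho(theta, f theta) + 1], any map within uniform distance
    [1] of [f'] on the ball of radius [n] leaves this ball invariant.
    In the metric of the space such maps contain the ball of radius
    [phi^-1(1/n) / 2] around [f'].  On the other hand the distance from [f] to
    [f'] is at most [g] times a constant by (C4), so [g] may be taken
    proportional to [r]; then [1/n] is of order [r], and concavity of [phi]
    near [0] makes [phi] of the pore radius at least a multiple of [r].  This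
    already gives [phi]-porosity, and [sqrt (c r) >= r] for small [r]. *)

(** * Porosity from explicit pores *)

(** One pore of radius [s] suffices: as [A x] holds, [pore_radius x r A] is a real number between
    [s] and [r], and monotonicity of [psi] below [d] carries the bound from [s] to it. *)
Lemma porous_at_lower_bound {R : realType} {M : metricType R} (psi : R -> R)
    (A : set M) (x : M) (c d : R) : 0 < c -> 0 < d -> A x ->
  (forall s t, 0 < s -> s <= t -> t < d -> psi s <= psi t) ->
  (\forall r \near 0^'+, exists s : R, [/\ 0 < s, c * r <= psi s &
     exists x', ball x' s `<=` ball x r `\` A]) ->
  porous_at psi A x.
Proof.
move=> c0 d0 Ax psi_le pores; rewrite /porous_at limf_einfE.
apply: (@lt_le_trans _ _ c%:E); first by rewrite lte_fin.
(* The lower limit is a supremum of infima over neighbourhoods, so one neighbourhood with infimum at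
   least [c] is enough. *)
pose V := [set r : R | [/\ 0 < r, r < d & exists s : R,
  [/\ 0 < s, c * r <= psi s & exists x', ball x' s `<=` ball x r `\` A]]].
apply: ereal_sup_ge; eexists; first (exists V; last reflexivity).
  near=> r; split; first by near: r; exact: nbhs_right_gt.
    by near: r; exact: nbhs_right_lt.
  by near: r; exact: pores.
apply/ereal_infP => _ [r [r0 rd [s [s0 crs pore]]] <-].
have sp : (s%:E <= pore_radius x r A)%E by apply: ereal_sup_ubound; exists s.
have := pore_radius_le r Ax; move: sp; case: (pore_radius x r A) => [p| |]//.
rewrite !lee_fin => sp pr /=.
rewrite ler_pdivlMr// (le_trans crs)// psi_le//.
exact: le_lt_trans rd.
Unshelve. all: by end_near. Qed.

(** * Admissible functions near zero *)

Section admissible_theory.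
Context {R : realType} {I : set R} {phi : R -> R} (adm : admissible I phi).

Lemma admissible_mem t : 0 < t < 1 -> I t.
Proof.
by move=> /andP[t0 t1]; case: (admissible_dom adm) => ->;
  rewrite /= in_itv/= t0 ?(ltW t1).
Qed.

Lemma admissible_le s t : I s -> I t -> s <= t -> phi s <= phi t.
Proof.
move=> Is It; rewrite le_eqVlt => /predU1P[->//|st].
by apply/ltW/(admissible_increasing adm) => //; rewrite inE.
Qed.

(* Near [0], [phi] lies above its chords from the origin: compare with the chord
   from [z] and let [z] tend to [0], using only that [phi z] is positive. *)
Lemma admissible_star : exists2 eta, 0 < eta <= 1 &
  forall t u, 0 < t -> t <= u -> u < eta -> t / u * phi u <= phi t.
Proof.
have [eta [Ieta conc _]] := admissible_C1 adm.
have eta0 := admissible_dom_gt0 adm Ieta.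
have eta1 : eta <= 1.
  by case: (admissible_dom adm) Ieta => -> /=; rewrite in_itv/= => /andP[_] // /ltW.
exists eta; first by rewrite eta0.
move=> t u t0 tu ueta; have u0 := lt_le_trans t0 tu.
have phi0 z : 0 < z -> z < eta -> 0 < phi z.
  move=> z0 zeta; apply: (admissible_pos adm); apply: admissible_mem.
  by rewrite z0 (lt_le_trans zeta).
have phiu := phi0 _ u0 ueta.
apply/ler_addgt0Pr => e e0.
have [<-|ntu] := eqVneq t u; first by rewrite divff ?gt_eqF// mul1r lerDl ltW.
have {ntu}tu : t < u by rewrite lt_neqAle ntu.
(* The first entry keeps [z] below [t]; the second makes [z / u * phi u] at most the slack [e]. *)
pose z := Num.min (t / 2) (e * u / phi u).
have z0 : 0 < z by rewrite lt_min !divr_gt0// mulr_gt0.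
have zt : z < t by rewrite gt_min; apply/orP; left; lra.
have zu : z < u by exact: lt_trans tu.
have ze : z / u * phi u <= e.
  by rewrite mulrAC ler_pdivrMr// -ler_pdivlMr// ge_min lexx orbT.
have uz0 : 0 < u - z by rewrite subr_gt0.
pose l : R := (u - t) / (u - z).
have l0 : 0 <= l by rewrite divr_ge0 ?ltW// subr_gt0.
have l1 : l <= 1 by rewrite ler_pdivrMr// mul1r lerD2l lerN2 ltW.
have zeta := lt_trans zu ueta.
have : - phi (l * z + (1 - l) * u) <= l * - phi z + (1 - l) * - phi u.
  by apply: (conc (Itv01 l0 l1) z u); rewrite inE/= in_itv/= ?z0 ?u0.
have -> : l * z + (1 - l) * u = t by rewrite /l; field; rewrite gt_eqF.
rewrite !mulrN -opprD lerN2 => phit.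
have phiz := phi0 _ z0 zeta.
have : (t / u - z / u) * phi u <= (1 - l) * phi u.
  rewrite ler_wpM2r ?(ltW phiu)// -mulrBl.
  have -> : 1 - l = (t - z) / (u - z) by rewrite /l; field; rewrite gt_eqF.
  by rewrite ler_wpM2l ?subr_ge0 ?(ltW zt)// lef_pV2 ?posrE// lerBlDr lerDl ltW.
have := mulr_ge0 l0 (ltW phiz).
by rewrite mulrBl; lra.
Qed.

End admissible_theory.

(** * Comparing the metric with uniform distances on balls *)

Section distance_theory.
Context {R : realType} {X : metricType R} (theta : X).
Context {I : set R} {phi : R -> R} (adm : admissible I phi).

Let w n := inv_on I phi n%:R^-1.
Let K := limn (fun N : nat => \sum_(1 <= n < N) n%:R * w n).

Lemma nneg_series_homo (u : nat -> R) : (forall n, (0 < n)%N -> 0 <= u n) ->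
  nondecreasing_seq (fun N : nat => \sum_(1 <= n < N) u n).
Proof.
move=> u0; apply/nondecreasing_seqP => -[|n]; first by rewrite !big_geq.
by rewrite [leRHS]big_nat_recr//= lerDl u0.
Qed.

Lemma weighted_series_gt0 : 0 < K.
Proof.
have w0 n : (0 < n)%N -> 0 < n%:R * w n.
  by move=> n0; rewrite mulr_gt0 ?ltr0n//; exact: (weight_gt0 adm).
have homo := nneg_series_homo _ (fun n n0 => ltW (w0 n n0)).
have := nondecreasing_cvgn_le homo (admissible_C4 adm) 2.
by rewrite big_nat1; apply: lt_le_trans; exact: w0.
Qed.

Section pair.
Context {f g : X -> X} (Nf : nonexpansive f) (Ng : nonexpansive g).

Let term n := w n * (dist_ball theta n f g / (1 + dist_ball theta n f g)).

Let term_ge0 n : (0 < n)%N -> 0 <= term n.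
Proof.
move=> n0; have d0 := dist_ball_ge0 theta n Nf Ng.
by rewrite mulr_ge0 ?(ltW (weight_gt0 adm n0))// divr_ge0 ?addr_ge0.
Qed.

Let term_le n c : (0 < n)%N -> dist_ball theta n f g <= c * n%:R ->
  term n <= c * (n%:R * w n).
Proof.
move=> n0 dc; have d0 := dist_ball_ge0 theta n Nf Ng.
rewrite /term [leRHS]mulrA [leRHS]mulrC ler_wpM2l ?(ltW (weight_gt0 adm n0))//.
by rewrite (le_trans _ dc)// ler_pdivrMr ?ltr_wpDr// ler_peMr// lerDl.
Qed.

(** Since [d / (1 + d) <= d], linear growth in [n] makes the series dominated by [c] times the one
    in (C4). *)
Lemma dist_phi_cvg_le c :
  (forall n, (0 < n)%N -> dist_ball theta n f g <= c * n%:R) ->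
  cvgn (fun N : nat => \sum_(1 <= n < N) term n) /\
  dist_phi theta I phi f g <= c * K.
Proof.
move=> dc; have c0 : 0 <= c.
  have := dc 1 isT; rewrite mulr1; apply: le_trans; exact: dist_ball_ge0.
have c4 := admissible_C4 adm.
have bound N : \sum_(1 <= n < N) term n <= c * K.
  apply: (@le_trans _ _ (c * \sum_(1 <= n < N) n%:R * w n)).
    rewrite mulr_sumr big_nat [leRHS]big_nat; apply: ler_sum => n /andP[n0 _].
    by apply: term_le => //; exact: dc.
  rewrite ler_wpM2l// (nondecreasing_cvgn_le _ c4)//.
  by apply: nneg_series_homo => n n0; rewrite mulr_ge0// ltW// (weight_gt0 adm).
have cv : cvgn (fun N : nat => \sum_(1 <= n < N) term n).
  apply: nondecreasing_is_cvgn; first exact: nneg_series_homo.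
  by exists (c * K) => _ [N _ <-].
by split => //; apply: limr_le => //; near=> N; exact: bound.
Unshelve. all: by end_near. Qed.

Lemma dist_phi_ge_term n : (0 < n)%N -> term n <= dist_phi theta I phi f g.
Proof.
move=> n0; pose D := mdist (f theta) (g theta).
(* Nonexpansive maps differ by at most [D + 2 * m <= (D + 2) * m] on the ball of radius [m]. *)
have [|cv _] := dist_phi_cvg_le (D + 2).
  move=> m m0; apply: ge_sup.
    by exists D; exists theta => //; exact: cball_center.
  move=> _ [x xB <-].
  have := le_trans (Nf theta x) xB; have := le_trans (Ng theta x) xB.
  have := metric_triangle (f x) (f theta) (g x).
  have := metric_triangle (f theta) (g theta) (g x).
  rewrite (metric_sym (f x) (f theta)) -/D.
  have : D <= D * m%:R by rewrite ler_peMr ?mdist_ge0// ler1n.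
  by rewrite mulrDl; lra.
have h := nneg_series_homo _ term_ge0.
apply: le_trans (nondecreasing_cvgn_le h cv n.+1).
rewrite big_nat_recr//= lerDr big_nat; apply: sumr_ge0 => k /andP[k0 _].
exact: term_ge0.
Qed.

(** The [n]-th term alone stays below [w n / 2], and [d / (1 + d) < 1 / 2] means [d < 1]. *)
Lemma dist_ball_lt1 n : (0 < n)%N -> dist_phi theta I phi f g < w n / 2 ->
  dist_ball theta n f g < 1.
Proof.
move=> n0 /(le_lt_trans (dist_phi_ge_term _ n0)).
have d0 := dist_ball_ge0 theta n Nf Ng.
rewrite /term ltr_pM2l ?(weight_gt0 adm)// ltr_pdivrMr ?ltr_wpDr//.
lra.
Qed.

End pair.
End distance_theory.

(** * Contraction towards the base point *)

Section geodesic_pull.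
Context {R : realType} {X : metricType R} {S : set (set X)}.
Context (hypS : hyperbolic S).

(** Rules out the default values of [xget]: the point with parameter [l * mdist x y] on the segment
    is a witness. *)
Lemma geod_combP l x y (z := geod_comb S l x y) : 0 <= l <= 1 ->
  mdist x z = l * mdist x y /\ mdist z y = (1 - l) * mdist x y.
Proof.
move=> /andP[l0 l1].
suff [] : [/\ seg S x y z, mdist x z = l * mdist x y
             & mdist z y = (1 - l) * mdist x y] by [].
apply: (@xgetPex _ x [set z | [/\ seg S x y z, mdist x z = l * mdist x y
             & mdist z y = (1 - l) * mdist x y]]).
have [A [SA _]] := hyperbolic_unique hypS x y.
have [_ [c [cE c0 c1] segE]] : S (seg S x y) /\ metric_segment x y (seg S x y).
  by apply: (@xgetPex _ set0 [set A | S A /\ metric_segment x y A]); exists A.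
have d0 := mdist_ge0 x y.
have ld0 : 0 <= l * mdist x y by rewrite mulr_ge0.
have ld1 : l * mdist x y <= mdist x y by rewrite ler_piMl.
have in0 : 0 \in `[0, mdist x y] by rewrite in_itv/= lexx.
have in1 : mdist x y \in `[0, mdist x y] by rewrite in_itv/= lexx andbT.
have inl : l * mdist x y \in `[0, mdist x y] by rewrite in_itv/= ld0.
exists (c (l * mdist x y)); split; first by rewrite segE; exists (l * mdist x y).
  by rewrite -[X in mdist X _ = _]c0 cE// sub0r normrN ger0_norm.
rewrite -[X in mdist _ X = _]c1 cE// ler0_norm ?subr_le0//.
by rewrite mulrBl mul1r opprB.
Qed.

(** The weight [l] stays on [f x], so the strength [g] of the contraction is [1 - l]. *)
Definition pull (theta : X) (l : R) (f : X -> X) (x : X) : X :=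
  geod_comb S l theta (f x).

Context (theta : X) (l : R) (l01 : 0 <= l <= 1) (f : X -> X) (Nf : nonexpansive f).

Let D := mdist theta (f theta).

Lemma pull_nonexpansive : nonexpansive (pull theta l f).
Proof.
move=> x y; rewrite (le_trans (hyperbolic_comb hypS _ _ _ l01))//.
rewrite (le_trans _ (Nf x y))// ler_piMl ?mdist_ge0//.
by case/andP: l01.
Qed.

Let mdist_image n x : cball theta n%:R x -> mdist theta (f x) <= n%:R + D.
Proof.
move=> xB; apply: le_trans (metric_triangle _ (f theta) _) _.
by rewrite addrC lerD2r (le_trans (Nf _ _)).
Qed.

Lemma dist_ball_pull n :
  dist_ball theta n f (pull theta l f) <= (1 - l) * (n%:R + D).
Proof.
apply: ge_sup.
  exists (mdist (f theta) (pull theta l f theta)).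
  by exists theta => //; exact: cball_center.
move=> _ [x xB <-].
rewrite metric_sym (geod_combP _ theta (f x) l01).2 ler_wpM2l ?mdist_image//.
by rewrite subr_ge0; case/andP: l01.
Qed.

(** On the ball, [pull] lands within [l * (n + D)] of [theta], which leaves room [1] for the
    perturbation [g]. *)
Lemma pull_stable n g : nonexpansive g -> D + 1 <= (1 - l) * n%:R ->
  dist_ball theta n (pull theta l f) g <= 1 ->
  g @` cball theta n%:R `<=` cball theta n%:R.
Proof.
move=> Ng Dn d1 _ [x xB <-]; rewrite /cball/=.
have := dist_ball_ge pull_nonexpansive Ng xB.
have := metric_triangle theta (pull theta l f x) (g x).
rewrite (geod_combP _ theta (f x) l01).1.
case/andP: l01 => l0 l1.
have := ler_wpM2l l0 (mdist_image _ _ xB).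
have : l * D <= D by rewrite ler_piMl// mdist_ge0.
by move: Dn; rewrite mulrBl mulrDr mul1r; lra.
Qed.

End geodesic_pull.

(** * Pores around contracted maps *)

Section pores.
Context {R : realType} {X : metricType R} {S : set (set X)}.
Context (hypS : hyperbolic S) (theta : X).
Context {I : set R} {phi : R -> R} (adm : admissible I phi).

Let w n := inv_on I phi n%:R^-1.
Let K := limn (fun N : nat => \sum_(1 <= n < N) n%:R * w n).

(** Here [t] is twice the pore radius: [t <= w n] gives uniform distance below [1] on the ball of
    radius [n], while [t <= r] and the bound with [K] each use up half of [r]. *)
Lemma invariant_ball_pore (f : nonexp_space theta adm)
    (D := mdist theta (nonexp_fun f theta)) (g t r : R) (n : nat) :
  0 < g <= 1 -> (0 < n)%N -> D + 1 <= g * n%:R -> g * (D + 1) * K <= r / 2 ->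
  t <= w n -> t <= r ->
  exists f' : nonexp_space theta adm, forall h : nonexp_space theta adm,
    mdist f' h < t / 2 ->
    mdist f h < r /\
    nonexp_fun h @` cball theta n%:R `<=` cball theta n%:R.
Proof.
move=> /andP[g0 g1] n0 gn gr tw tr.
have Nfun (h : nonexp_space theta adm) : nonexpansive (nonexp_fun h).
  exact: set_valP.
have D0 : 0 <= D := mdist_ge0 _ _.
have l01 : 0 <= 1 - g <= 1 by rewrite subr_ge0 g1 gerBl ltW.
have Npull := pull_nonexpansive hypS theta _ l01 _ (Nfun f).
pose f' : nonexp_space theta adm := SigSub (mem_set Npull).
have f'E : nonexp_fun f' = @pull _ _ S theta (1 - g) (nonexp_fun f) by [].
have ff' : mdist f f' <= r / 2.
  apply: le_trans gr; rewrite nonexp_mdistE.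
  (* The slope is [g * (D + 1)], as [m + D <= (D + 1) * m] for [m >= 1]. *)
  apply: (dist_phi_cvg_le _ adm (Nfun f) (Nfun f') _ _).2 => m m0.
  rewrite f'E (le_trans (dist_ball_pull hypS _ _ l01 _ (Nfun f) m))//.
  rewrite subKr -mulrA ler_wpM2l ?(ltW g0)//.
  by rewrite mulrDl mul1r addrC lerD2r ler_peMr// ler1n.
exists f' => h f'h; split.
  by apply: le_lt_trans (metric_triangle _ f' _) _; lra.
apply: (pull_stable hypS _ _ l01 _ (Nfun f) _ _ (Nfun h)).
  by rewrite subKr.
rewrite -f'E ltW// (dist_ball_lt1 _ adm (Nfun f') (Nfun h) _ n0)//.
by rewrite -nonexp_mdistE (lt_le_trans f'h)// ler_pM2r// invr_gt0.
Qed.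

(** The witness for [F], chosen so that the property required of its members holds by definition. *)
Definition invariant_ball_maps : set (nonexp_space theta adm) :=
  [set f | exists2 Mf : R, 0 < Mf &
     nonexp_fun f @` cball theta Mf `<=` cball theta Mf].

Lemma invariant_ball_pores (f : nonexp_space theta adm) :
  exists2 c : R, 0 < c & \forall r \near 0^'+, exists s : R,
    [/\ 0 < s, c * r <= phi s &
      exists f', ball f' s `<=` ball f r `\` ~` invariant_ball_maps].
Proof.
have [eta /andP[eta0 eta1] star] := admissible_star adm.
pose D := mdist theta (nonexp_fun f theta).
have D0 : 0 <= D := mdist_ge0 _ _.
have K0 : 0 < K := weighted_series_gt0 adm.
pose u := eta / 2.
have u0 : 0 < u by rewrite divr_gt0.
have ueta : u < eta by rewrite /u; lra.
have phiu : 0 < phi u.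
  by apply/(admissible_pos adm)/(admissible_mem adm); rewrite u0 (lt_le_trans ueta).
(* With [g = r / C] this gives [g * (D + 1) * K = r / 2] exactly. *)
pose C := 2 * (D + 1) * K.
have C0 : 0 < C by rewrite !mulr_gt0// ltr_wpDl.
(* The entries serve the two cases of [t = min (w n, r)]: [phi (w n) = 1 / n], and the chord bound
   for [phi r] from [u]. *)
pose b := Num.min ((C * (D + 2))^-1) (phi u / u).
have b0 : 0 < b by rewrite lt_min invr_gt0 mulr_gt0 ?divr_gt0// ltr_wpDl.
exists (b / 2); first by rewrite divr_gt0.
near=> r.
have r0 : 0 < r by near: r; exact: nbhs_right_gt.
have ru : r < u by near: r; exact: nbhs_right_lt.
have rC : r < C by near: r; exact: nbhs_right_lt.
pose g := r / C.
have g0 : 0 < g by rewrite divr_gt0.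
have g1 : g <= 1 by rewrite ler_pdivrMr// mul1r ltW.
(* Rounding up costs at most [g <= 1], so [g * n] lies between [D + 1] and [D + 2] and [1 / n] is of
   order [r]. *)
pose n := (Num.truncn ((D + 1) / g)).+1.
have gn : D + 1 <= g * n%:R.
  by rewrite mulrC -ler_pdivrMr// ltW// truncnS_gt.
have ng : g * n%:R <= D + 2.
  rewrite /n -natr1 mulrDr mulr1 (_ : D + 2 = (D + 1) + 1) ?lerD//; last by ring.
  by rewrite mulrC -ler_pdivlMr// truncn_le divr_ge0 ?addr_ge0// ltW.
have [Iw phiw] : I (w n) /\ phi (w n) = n%:R^-1.
  apply: (inv_onP adm); rewrite invr_gt0 ltr0n/= invf_le1 ?ltr0n// ler1n//.
have w0 : 0 < w n := weight_gt0 adm (ltn0Sn _).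
pose t := Num.min (w n) r.
have t0 : 0 < t by rewrite lt_min w0.
have phit : b * r <= phi t.
  rewrite /t; case: (leP (w n) r) => _.
    rewrite phiw; apply: (@le_trans _ _ ((C * (D + 2))^-1 * r)).
      by rewrite ler_pM2r// ge_min lexx.
    rewrite invfM mulrAC mulrC -(mulrC r) -/g.
    by rewrite mulrC ler_pdivrMr ?ltr_wpDl// mulrC ler_pdivlMr ?ltr0n.
  have rIn : r / u * phi u <= phi r by apply: star => //; exact: ltW.
  apply: le_trans rIn; rewrite mulrAC -mulrA [leRHS]mulrC ler_pM2r//.
  by rewrite ge_min lexx orbT.
have tr : t <= r by rewrite ge_min lexx orbT.
exists (t / 2); split; first by rewrite divr_gt0.
  (* Halving [t] at most halves [phi t], whence the constant [b / 2]. *)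
  have := star (t / 2) t; rewrite divr_gt0// => /(_ isT).
  have -> : t / 2 / t = 1 / 2 by field; rewrite gt_eqF.
  move=> /(_ _ _)/(le_trans _); apply; lra.
have [||||||f' Hf'] := invariant_ball_pore f g t r n => //.
- by rewrite g0.
- rewrite -/D (_ : _ * K = r / 2)// /g /C; field.
  by rewrite !gt_eqF// ltr_wpDl.
- by rewrite ge_min lexx.
exists f' => h; rewrite !ballEmdist/= => /Hf'[fh hn].
split=> //; apply; exists n%:R => //; by rewrite ltr0n.
Unshelve. all: by end_near. Qed.

End pores.

(** * Porosity of the complement for both gauges *)

Theorem theorem3p1 (R : realType) (X : metricType R) (S : set (set X))
    (hypX : hyperbolic S) (complX : complete_metric X)
    (unbX : unbounded_metric X) (theta : X)
    (I : set R) (phi : R -> R) (adm : admissible I phi) :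
  exists F : set (nonexp_space theta adm),
    [/\ porous (fun t => Num.sqrt (phi t)) (~` F),
        (forall f, F f -> exists2 Mf : R, 0 < Mf &
           nonexp_fun f @` cball theta Mf `<=` cball theta Mf)
      & (forall a b t : R, 1 <= a -> 1 <= b -> 0 < t < 1 ->
           inv_on I phi (t / (a + b)) <=
             inv_on I phi (t / a) * inv_on I phi (t / b)) ->
        porous phi (~` F)].
Proof.
have phi_le s t : 0 < s -> s <= t -> t < 1 -> phi s <= phi t.
  move=> s0 st t1; apply: (admissible_le adm) => //; apply: (admissible_mem adm).
    by rewrite s0 (le_lt_trans st).
  by rewrite (lt_le_trans s0).
exists (@invariant_ball_maps _ _ theta _ _ adm); split => //.
- move=> f Ff; have [c c0 pores] := invariant_ball_pores hypX _ adm f.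
  apply: (@porous_at_lower_bound _ _ _ _ _ 1 1) => //.
    by move=> s t s0 st t1; rewrite ler_wsqrtr ?phi_le.
  near=> r; have [s [s0 crs pore]] : exists s : R, [/\ 0 < s, c * r <= phi s &
      exists f', ball f' s `<=` ball f r `\` ~` @invariant_ball_maps _ _ theta _ _ adm].
    by near: r; exact: pores.
  have r0 : 0 < r by near: r; exact: nbhs_right_gt.
  (* Now [r ^ 2 <= c * r <= phi s], so the square root gauge admits the constant [1]. *)
  have rc : r < c by near: r; exact: nbhs_right_lt.
  exists s; split => //; rewrite mul1r -(ger0_norm (ltW r0)) -sqrtr_sqr ler_wsqrtr//.
  by rewrite (le_trans _ crs)// expr2 ler_pM2r// ltW.
- move=> _ f Ff; have [c c0 pores] := invariant_ball_pores hypX _ adm f.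
  exact: (@porous_at_lower_bound _ _ _ _ _ c 1).
Unshelve. all: by end_near. Qed.
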